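(* Let $n\ge 1$, let $G$ and $H$ be undirected simple graphs on the vertex set $N=\{1,\dots,n\}$, and let $V_1,\dots,V_r$ be the partition of $N$ such that each $V_i$ is the vertex set of a connected component of $G\cap H$. Then $$\mathcal M(G,H)=\bigoplus_{i=1}^r \mathcal M(G|_{V_i},H|_{V_i}),$$ i.e. every $\Sigma\in\mathcal M(G,H)$ has a block-diagonal structure with $r$ diagonal blocks having rows and columns indexed by the $V_i$. In particular, the correlation model satisfies $\mathcal M_1(G,H)=\{\mathbb 1_n\}$ if and only if $E_G\cap E_H=\emptyset$.
   Context: $E_G$ denotes the edge set of a graph $G$; $G\cap H$ is the graph on $N$ with edge set $E_G\cap E_H$ (isolated vertices count as connected components); $G|_V$ is the induced subgraph of $G$ on $V\subseteq N$. For a finite set $V$, $\mathrm{PD}_V$ is the set of real symmetric positive definite matrices with rows and columns indexed by $V$. For graphs $G,H$ on a finite vertex set $V$, $$\mathcal M(G,H)=\{\Sigma\in\mathrm{PD}_V : (\Sigma^{-1})_{ij}=0 \text{ for all } i\ne j,\ ij\notin E_G;\ \Sigma_{kl}=0\text{ for all } k\neq l,\ kl\notin E_H\}.$$ $\mathcal M_1(G,H)$ is the set of $\Sigma\in\mathcal M(G,H)$ all of whose diagonal entries equal $1$. For sets $A_i\subseteq \mathrm{PD}_{V_i}$ with $V_1,\dots,V_r$ a partition of $N$, $\bigoplus_i A_i\subseteq\mathrm{PD}_N$ denotes the set of all block-diagonal matrices whose diagonal block with rows and columns indexed by $V_i$ lies in $A_i$ and all of whose other entries are zero. $\mathbb 1_n$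 is the identity matrix. *)

(* Defs.v *)
From HB Require Import structures.
From mathcomp Require Import all_boot all_order all_algebra.
From mathcomp Require Import classical_sets reals.

Set Implicit Arguments.
Unset Strict Implicit.
Unset Printing Implicit Defensive.

Import Order.TTheory GRing.Theory Num.Theory.
Local Open Scope ring_scope.

(* Finite simple graph on T, given by its edge set: edges are 2-element sets. *)
Record sgraph (T : finType) := SGraph {
  edges : {set {set T}};
  edges_card2 : forall e, e \in edges -> #|e| = 2
}.

Definition adj (T : finType) (G : sgraph T) : rel T :=
  fun x y => [set x; y]%SET \in edges G.

Lemma graphI_card2 (T : finType) (G H : sgraph T) e :
  e \in edges G :&: edges H -> #|e| = 2.
Proof. by rewrite inE => /andP[/edges_card2]. Qed.

Definition graphI (T : finType) (G H : sgraph T) : sgraph T :=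
  SGraph (@graphI_card2 T G H).

(* The set of vertex sets of the connected components; an isolated vertex x
   contributes the class [set x]. *)
Definition components (T : finType) (G : sgraph T) : {set {set T}} :=
  equivalence_partition (connect (adj G)) [set: T]%SET.

(* A subset V is indexed by 'I_#|V| through [enum_val], which for T := 'I_n is
   the increasing enumeration of V. Both induced subgraphs on V and submatrices
   with rows and columns in V use this indexing. *)
Definition vtx (T : finType) (V : {set T}) (k : 'I_#|V|) : T := enum_val k.

Definition induced_edges (T : finType) (G : sgraph T) (V : {set T}) :
    {set {set 'I_#|V|}} :=
  [set e : {set 'I_#|V|} | (@vtx T V @: e)%SET \in edges G]%SET.

Lemma induced_card2 (T : finType) (G : sgraph T) (V : {set T}) e :
  e \in induced_edges G V -> #|e| = 2.
Proof.
by rewrite inE => /edges_card2; rewrite card_imset //; exact: enum_val_inj.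
Qed.

Definition induced (T : finType) (G : sgraph T) (V : {set T}) :
    sgraph 'I_#|V| :=
  SGraph (@induced_card2 T G V).

Definition PD (R : realType) (m : nat) : set 'M[R]_m :=
  [set S : 'M[R]_m | S^T = S /\
     forall x : 'cV[R]_m, x != 0 -> 0 < (x^T *m S *m x) ord0 ord0]%classic.
Arguments PD R m : clear implicits.

Definition model (R : realType) (m : nat) (G H : sgraph 'I_m) :
    set 'M[R]_m :=
  [set S : 'M[R]_m |
     [/\ PD R m S,
         forall i j, i != j -> [set i; j]%SET \notin edges G ->
           invmx S i j = 0
       & forall k l, k != l -> [set k; l]%SET \notin edges H ->
           S k l = 0]]%classic.
Arguments model R {m} G H.

Definition corr_model (R : realType) (m : nat) (G H : sgraph 'I_m) :
    set 'M[R]_m :=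
  [set S : 'M[R]_m | model R G H S /\ forall i, S i i = 1]%classic.
Arguments corr_model R {m} G H.

(* Meaningful when the V i are the (distinct) blocks of a partition of 'I_n. *)
Definition block_dsum (R : realType) (n r : nat) (V : 'I_r -> {set 'I_n})
    (A : forall i, set 'M[R]_#|V i|) : set 'M[R]_n :=
  [set S : 'M[R]_n |
     (forall i, A i (mxsub (@vtx _ (V i)) (@vtx _ (V i)) S)) /\
     (forall k l, (forall i, ~~ ((k \in V i) && (l \in V i))) ->
        S k l = 0)]%classic.
Arguments block_dsum {R n r} V A.

(* Main.v *)
(** If the sign [p] is constant on the components of [graphI G H], conjugate
    [S] and [K = S^-1] by the diagonal sign matrix [D] of [p]. Since [S] and [K]
    have no common off-diagonal support outside the intersection graph, the
    trace of [S (D K D)] is still that of [S K], and this forces [D S D = S]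
    (equality in an AM-GM inequality for traces), i.e. [S] vanishes between
    vertices of different sign. Conversely, the inverse of a block-diagonal
    matrix is computed blockwise. For the correlation model, a common edge [kl]
    allows the non-identity matrix with [1/2] at the entries [kl] and [lk]. *)

Require Import Defs.
From mathcomp Require Import all_boot all_order all_algebra.
From mathcomp Require Import classical_sets reals.
From mathcomp Require Import ring lra.

Set Implicit Arguments.
Unset Strict Implicit.
Unset Printing Implicit Defensive.

Import Order.TTheory GRing.Theory Num.Theory.
Local Open Scope ring_scope.

(** * Positive definite matrices: congruence, factorization and a trace criterion *)

Lemma quad_formE (R : pzRingType) (m : nat) (S : 'M[R]_m) (x : 'cV[R]_m) :
  (x^T *m S *m x) ord0 ord0
  = \sum_k \sum_l x k ord0 * S k l * x l ord0.
Proof.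
rewrite mxE exchange_big; apply: eq_bigr => l _.
by rewrite mxE mulr_suml; apply: eq_bigr => k _; rewrite mxE.
Qed.

Lemma PD_unitmx (R : realType) (m : nat) (S : 'M[R]_m) :
  PD R m S -> S \in unitmx.
Proof.
case=> symS posS; rewrite -row_free_unit -kermx_eq0.
apply: contraT => /rowV0Pn[v /sub_kermxP vS v0].
have /posS : v^T != 0 by rewrite -trmx0 (inj_eq trmx_inj).
by rewrite trmxK vS mul0mx mxE ltxx.
Qed.

(** The left inverse [W] makes [U] injective, so a nonzero [x] gives a nonzero [U *m x], at which
    the form of [S] is positive. *)
Lemma PD_congr (R : realType) (m p : nat) (S : 'M[R]_m)
    (U : 'M[R]_(m, p)) (W : 'M[R]_(p, m)) :
  W *m U = 1%:M -> PD R m S -> PD R p (U^T *m S *m U).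
Proof.
move=> WU [symS posS]; split; first by rewrite !trmx_mul trmxK symS mulmxA.
move=> x x0; have /posS : U *m x != 0.
  by apply: contraNneq x0 => Ux0; rewrite -[x]mul1mx -WU -mulmxA Ux0 mulmx0.
by rewrite trmx_mul !mulmxA.
Qed.

(** With [K] the inverse of [S], symmetry gives [K = K^T *m S *m K], a congruence. *)
Lemma PD_invmx (R : realType) (m : nat) (S : 'M[R]_m) :
  PD R m S -> PD R m (invmx S).
Proof.
move=> pdS; have unitS := PD_unitmx pdS.
have := PD_congr (mulmxV unitS) pdS.
by rewrite trmx_inv (proj1 pdS) mulVmx // mul1mx.
Qed.

Lemma PD_mxsub (R : realType) (m p : nat) (f : 'I_p -> 'I_m) (S : 'M[R]_m) :
  injective f -> PD R m S -> PD R p (mxsub f f S).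
Proof.
move=> injf pdS; pose E : 'M[R]_(p, m) := rowsub f 1%:M.
have ET : E^T = colsub f 1%:M by rewrite trmx_mxsub trmx1.
have -> : mxsub f f S = E^T^T *m S *m E^T.
  rewrite trmxK ET -[S in LHS]mulmx1 mxsub_mul; congr (_ *m _).
  by rewrite mul_rowsub_mx mul1mx.
apply: (PD_congr (W := E) _ pdS).
rewrite ET -mxsub_mul mulmx1; apply/matrixP => i j.
by rewrite !mxE (inj_eq injf).
Qed.

(** Induction on the size: split off the first row and column, and factor the Schur complement
    [C - a^-1 *: (b^T *m b)] of the corner entry [a]. *)
Lemma PD_cholesky (R : realType) (m : nat) (S : 'M[R]_m) :
  PD R m S -> exists L : 'M[R]_m, S = L^T *m L.
Proof.
elim: m S => [|m IH] S; first by exists 0; rewrite [S]flatmx0 [RHS]flatmx0.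
rewrite -[m.+1]/(1 + m)%N in S * => -[symS posS].
have [C [b [a Sdef]]] : exists (C : 'M[R]_m) (b : 'rV[R]_m) (a : R),
    S = block_mx a%:M b b^T C.
  exists (drsubmx S), (ursubmx S), (S ord0 ord0).
  rewrite trmx_ursub symS -[LHS]submxK; congr block_mx.
  by apply/matrixP => i j; rewrite !ord1 !mxE /= mulr1n;
    congr (S _ _); apply: val_inj.
have symC : C^T = C.
  by move: symS; rewrite Sdef tr_block_mx => /eq_block_mx[].
have quad (t : R) (y : 'cV[R]_m) :
    ((col_mx t%:M y)^T *m S *m col_mx t%:M y) ord0 ord0
    = a * t ^+ 2 + 2 * t * (b *m y) ord0 ord0 + (y^T *m C *m y) ord0 ord0.
  rewrite Sdef tr_col_mx mul_row_block mul_row_col tr_scalar_mx !mulmxDl.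
  rewrite !mul_scalar_mx !mul_mx_scalar.
  rewrite -(trmx_mul b y).
  rewrite -!scalemxAl !mxE !eqxx /= !mulr1n; ring.
have a_gt0 : 0 < a.
  have := posS (col_mx 1%:M 0); rewrite quad !mulmx0 !mxE.
  rewrite mulr0 !addr0 expr1n mulr1.
  by apply; rewrite col_mx_eq0 negb_and oner_eq0.
have pdC : PD R m (C - a^-1 *: (b^T *m b)).
  split; first by rewrite linearB linearZ /= trmx_mul trmxK symC.
  (* For fixed [y], this first coordinate minimizes the quadratic form of [S]; the minimum is the
     form of the Schur complement at [y]. *)
  move=> y y0; have := posS (col_mx (- a^-1 * (b *m y) ord0 ord0)%:M y).
  rewrite col_mx_eq0 negb_and y0 orbT quad => /(_ isT).
  have bb : (y^T *m (b^T *m b) *m y) ord0 ord0 = (b *m y) ord0 ord0 ^+ 2.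
    by rewrite mulmxA -trmx_mul -mulmxA mxE big_ord1 mxE expr2.
  rewrite mulmxBr mulmxBl -scalemxAr -scalemxAl.
  rewrite [X in _ -> 0 < X]mxE [X in _ -> 0 < _ + X]mxE.
  rewrite [X in _ -> 0 < _ - X]mxE bb.
  by congr (0 < _); field; exact: lt0r_neq0.
have [L Ldef] := IH _ pdC.
have s0 : Num.sqrt a != 0 by rewrite sqrtr_eq0 -ltNge.
exists (block_mx (Num.sqrt a)%:M ((Num.sqrt a)^-1 *: b) 0 L).
rewrite Sdef tr_block_mx mulmx_block !trmx0 !mul0mx !mulmx0 !addr0.
rewrite -Ldef !tr_scalar_mx -scalar_mxM -expr2 sqr_sqrtr ?ltW //.
rewrite mul_scalar_mx mul_mx_scalar [(_ *: b)^T]linearZ /=.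
rewrite !scalerA divff // !scale1r.
rewrite -scalemxAl -scalemxAr scalerA -invfM -expr2 sqr_sqrtr ?ltW //.
by rewrite addrC subrK.
Qed.

(* With [B = L^T *m L], the trace is the sum of the values of the quadratic
   form [A] at the rows of [L *m X]. *)
Lemma PD_trace_eq0 (R : realType) (m : nat) (A B X : 'M[R]_m) :
  PD R m A -> PD R m B -> \tr (X *m A *m X^T *m B) = 0 -> X = 0.
Proof.
move=> [_ posA] pdB; have [L Ldef] := PD_cholesky pdB.
pose q i := ((row i (L *m X))^T^T *m A *m (row i (L *m X))^T) ord0 ord0.
have -> : \tr (X *m A *m X^T *m B) = \sum_i q i.
  rewrite Ldef mulmxA mxtrace_mulC -!mulmxA -trmx_mul !mulmxA.
  apply: eq_bigr => i _; rewrite /q trmxK -row_mul !mxE.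
  by apply: eq_bigr => k _; rewrite !mxE.
have q_ge0 i : 0 <= q i.
  have [r0|/posA/ltW//] := eqVneq ((row i (L *m X))^T) 0.
  by rewrite /q r0 mulmx0 mxE.
move=> /eqP; rewrite psumr_eq0 // => /allP q0.
have LX0 : L *m X = 0.
  apply/row_matrixP => i; rewrite row0; apply: trmx_inj; rewrite trmx0.
  have [//|/posA] := eqVneq ((row i (L *m X))^T) 0.
  by rewrite -/(q i) (eqP (q0 i (mem_index_enum _))) ltxx.
by rewrite -[X](mulKmx (PD_unitmx pdB)) Ldef -mulmxA LX0 !mulmx0.
Qed.

(** * Inverses of block-diagonal matrices, and vanishing between components *)

(** The hypothesis says that [S] commutes with the 0/1 diagonal matrix of [p]; then so does its
    inverse. *)
Lemma invmx_disconnected (F : fieldType) (m : nat) (S : 'M[F]_m)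
    (p : pred 'I_m) :
  S \in unitmx -> (forall i j, p i != p j -> S i j = 0) ->
  forall i j, p i != p j -> invmx S i j = 0.
Proof.
move=> unitS Sp i j pij; pose D := diag_mx (\row_k (p k)%:R : 'rV[F]_m).
have DS : D *m S = S *m D.
  apply/matrixP => k l; rewrite mul_diag_mx mul_mx_diag !mxE.
  by have [->|/Sp->] := eqVneq (p k) (p l); rewrite ?mulr0 ?mul0r // mulrC.
have : D *m invmx S = invmx S *m D.
  by rewrite -[LHS](mulKmx unitS) (mulmxA S) -DS -mulmxA mulmxV // mulmx1.
move/matrixP/(_ i j); rewrite mul_diag_mx mul_mx_diag !mxE.
by move: pij; case: (p i); case: (p j) => //= _;
  rewrite ?mul1r ?mul0r ?mulr1 ?mulr0.
Qed.

(** For rows and columns in [V], the sum defining an entry of [S *m invmx S] only runs over [V], so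
    the two submatrices are inverse to each other. *)
Lemma invmx_block (F : fieldType) (m : nat) (S : 'M[F]_m) (V : {set 'I_m}) :
  S \in unitmx -> (forall k l, (k \in V) != (l \in V) -> S k l = 0) ->
  invmx (mxsub (@vtx _ V) (@vtx _ V) S)
  = mxsub (@vtx _ V) (@vtx _ V) (invmx S).
Proof.
move=> unitS SV; set SS := mxsub _ _ S; set KK := mxsub _ _ (invmx S).
have SK : SS *m KK = 1%:M.
  apply/matrixP => a b; move: (mulmxV unitS) => /matrixP/(_ (vtx a) (vtx b)).
  rewrite !mxE (inj_eq enum_val_inj) => <-.
  rewrite [RHS](bigID (mem V)) /= [X in _ + X]big1 ?addr0.
    by rewrite [RHS]big_enum_val; apply: eq_bigr => k _; rewrite !mxE.
  by move=> k kV; rewrite SV ?mul0r // (negPf kV) enum_valP.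
have [unitSS _] := mulmx1_unit SK.
by rewrite -[RHS](mulKmx unitSS) SK mulmx1.
Qed.

(* Let [D] be the diagonal sign matrix of [p], [K] the inverse of [S],
   [S' = D S D] and [K' = D K D]. The entrywise product of [S] and [K] vanishes
   where the signs differ, so [S K'] and [S' K] have the same trace as [S K],
   and [(S - S') K (S - S') K' = S K' + S' K - 2] has trace zero. *)
Lemma model_disconnected (R : realType) (m : nat) (G H : sgraph 'I_m)
    (S : 'M[R]_m) (p : pred 'I_m) :
  model R G H S -> (forall i j, adj (graphI G H) i j -> p i = p j) ->
  forall i j, p i != p j -> S i j = 0.
Proof.
move=> [pdS SG SH] padj.
have unitS := PD_unitmx pdS.
pose d := \row_k (-1) ^+ (p k) : 'rV[R]_m; pose D := diag_mx d.
have DE A i j : (D *m A *m D) i j = d ord0 i * A i j * d ord0 j.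
  by rewrite mul_mx_diag mul_diag_mx !mxE.
have DD : D *m D = 1%:M.
  apply/matrixP => i j; rewrite mul_diag_mx !mxE.
  by case: eqP => [->|_]; rewrite ?mulr0 // mulr1n -expr2 sqrr_sign.
have DT : D^T = D by rewrite tr_diag_mx.
have PD_D A : PD R m A -> PD R m (D *m A *m D).
  by move=> pdA; rewrite -{1}DT; exact: (PD_congr DD pdA).
set K := invmx S in SG; pose S' := D *m S *m D; pose K' := D *m K *m D.
have pdK : PD R m K := PD_invmx pdS.
have trSK' : \tr (S *m K') = m%:R.
  rewrite -(mxtrace1 R m) -(mulmxV unitS) -/K.
  apply: eq_bigr => i _; rewrite !mxE; apply: eq_bigr => j _; rewrite DE !mxE.
  have [->|pij] := eqVneq (p j) (p i).
    by rewrite mulrAC -expr2 sqrr_sign mul1r.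
  have ij : i != j by apply: contraNneq pij => ->.
  have [ijG|/SG->] := boolP ([set j; i]%SET \in edges G); last first.
  - by rewrite eq_sym.
  - by rewrite !(mulr0, mul0r).
  have [ijH|/SH->] := boolP ([set i; j]%SET \in edges H); last first.
  - by [].
  - by rewrite !mul0r.
  move: pij; rewrite (padj j i) ?eqxx //.
  by rewrite /adj /= inE ijG finset.setUC ijH.
have trS'K : \tr (S' *m K) = m%:R.
  by rewrite -trSK' /S' /K' -!mulmxA mxtrace_mulC !mulmxA.
have S'K' : S' *m K' = 1%:M.
  rewrite /S' /K' !mulmxA -[D *m S *m D *m D]mulmxA DD mulmx1.
  by rewrite -(mulmxA D) mulmxV // mulmx1.
have XT : (S - S')^T = S - S'.
  by rewrite linearB /= (proj1 pdS) (proj1 (PD_D _ pdS)).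
have XX : (S - S') *m K *m (S - S')^T *m K'
    = S *m K' - 1%:M - (1%:M - S' *m K).
  rewrite XT -mulmxA !(mulmxBl S) mulmxV // S'K' mulmxBr mulmx1 mulmxBl mul1mx.
  by rewrite -(mulmxA S') (mulmxA K) mulVmx // mul1mx S'K'.
have : S - S' = 0.
  apply: (PD_trace_eq0 pdK (PD_D _ pdK)); rewrite -/K' XX.
  by rewrite !linearB /= trSK' trS'K mxtrace1 !subrr.
move/matrixP => SS' i j pij; have := SS' i j.
rewrite [LHS]mxE [X in _ + X]mxE DE !mxE.
(* Opposite signs give [S' i j = - S i j], which together with [S = S'] leaves only zero. *)
by move: pij; case: (p i); case: (p j) => //= _; rewrite ?expr1 ?expr0; lra.
Qed.

(** * Passing between a matrix and its blocks on the components *)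

Lemma vtx_pair (T : finType) (V : {set T}) (a b : 'I_#|V|) :
  (@vtx T V @: [set a; b])%SET = [set vtx a; vtx b]%SET.
Proof. by rewrite imsetU1 imset_set1. Qed.

Lemma vtx_surj (T : finType) (V : {set T}) x :
  x \in V -> exists a : 'I_#|V|, x = vtx a.
Proof.
by move=> xV; exists (enum_rank_in xV x); rewrite /vtx enum_rankK_in.
Qed.

Lemma model_induced (R : realType) (m : nat) (G H : sgraph 'I_m)
    (S : 'M[R]_m) (V : {set 'I_m}) :
  (forall k l, (k \in V) != (l \in V) -> S k l = 0) ->
  model R G H S ->
  model R (induced G V) (induced H V) (mxsub (@vtx _ V) (@vtx _ V) S).
Proof.
move=> SV [pdS SG SH]; split.
- exact: PD_mxsub (@enum_val_inj _ _) pdS.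
- move=> a b ab; rewrite inE vtx_pair => abG.
  by rewrite invmx_block ?PD_unitmx // mxE SG // (inj_eq enum_val_inj).
- move=> a b ab; rewrite inE vtx_pair => abH.
  by rewrite mxE SH // (inj_eq enum_val_inj).
Qed.

Lemma mem_components (T : finType) (G : sgraph T) (B : {set T}) x y :
  B \in components G -> x \in B -> (y \in B) = connect (adj G) x y.
Proof.
have symG : connect_sym (adj G).
  by apply: sym_connect_sym => u v; rewrite /adj finset.setUC.
case/imsetP => z _ ->; rewrite !inE /= => zx.
by rewrite (same_connect symG zx).
Qed.

Lemma components_cover (T : finType) (G : sgraph T) x :
  exists2 B, B \in components G & x \in B.
Proof.
exists [set y in [set: T]%SET | connect (adj G) x y]%SET.
  by apply/imsetP; exists x; rewrite ?inE.
by rewrite !inE connect0.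
Qed.

(** The map [c] sends a vertex to the index of its block. The quadratic form is the sum of those of
    the blocks, and a nonzero vector has a nonzero restriction to some block. *)
Lemma PD_block_dsum (R : realType) (n r : nat) (V : 'I_r -> {set 'I_n})
    (c : 'I_n -> 'I_r) (S : 'M[R]_n) :
  (forall k i, (k \in V i) = (c k == i)) ->
  block_dsum V (fun i => PD R #|V i|) S -> PD R n S.
Proof.
move=> cP [pdS S0].
have S0c k l : c k != c l -> S k l = 0.
  move=> kl; apply: S0 => i; rewrite !cP; apply: contraNN kl.
  by case/andP=> /eqP-> /eqP->.
split.
  apply/matrixP => k l; rewrite mxE; have [ckl|ckl] := eqVneq (c k) (c l).
    have [a ->] : exists a : 'I_#|V (c k)|, k = vtx a.
      by apply: vtx_surj; rewrite cP.
    have [b ->] : exists b : 'I_#|V (c k)|, l = vtx b.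
      by apply: vtx_surj; rewrite cP ckl.
    by have /matrixP/(_ a b) := proj1 (pdS (c k)); rewrite !mxE.
  by rewrite !S0c // eq_sym.
move=> x x0; pose y i := rowsub (@vtx _ (V i)) x.
pose SV i := mxsub (@vtx _ (V i)) (@vtx _ (V i)) S.
pose q i := ((y i)^T *m SV i *m y i) ord0 ord0.
have -> : (x^T *m S *m x) ord0 ord0 = \sum_i q i.
  rewrite quad_formE (partition_big c xpredT) //=; apply: eq_bigr => i _.
  rewrite /q quad_formE.
  under eq_bigl => k do rewrite -cP.
  rewrite [LHS]big_enum_val; apply: eq_bigr => a _.
  rewrite (bigID (mem (V i))) /= [X in _ + X]big1 ?addr0.
    by rewrite [LHS]big_enum_val; apply: eq_bigr => b _; rewrite !mxE.
  have /eqP ca : c (enum_val a) == i by rewrite -cP enum_valP.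
  by move=> l li; rewrite S0c ?mulr0 ?mul0r // ca eq_sym -cP.
have q_ge0 i : 0 <= q i.
  have [y0|y0] := eqVneq (y i) 0; first by rewrite /q y0 mulmx0 mxE.
  exact/ltW/(proj2 (pdS i)).
have /cV0Pn[k xk] := x0.
have [a ka] : exists a : 'I_#|V (c k)|, k = vtx a.
  by apply: vtx_surj; rewrite cP.
have yk : y (c k) != 0.
  by apply: contraNneq xk => /matrixP/(_ a ord0); rewrite !mxE -ka => ->.
rewrite (bigD1 (c k)) //= ltr_pwDl ?sumr_ge0 //.
exact: (proj2 (pdS (c k))).
Qed.

Lemma block_dsum_model (R : realType) (n r : nat) (V : 'I_r -> {set 'I_n})
    (c : 'I_n -> 'I_r) (G H : sgraph 'I_n)
    (S : 'M[R]_n) :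
  (forall k i, (k \in V i) = (c k == i)) ->
  block_dsum V (fun i => model R (induced G (V i)) (induced H (V i))) S ->
  model R G H S.
Proof.
move=> cP [modS S0].
have S0V i k l : (k \in V i) != (l \in V i) -> S k l = 0.
  move=> kl; apply: S0 => j; rewrite !cP; apply: contraNN kl.
  by rewrite !cP => /andP[/eqP-> /eqP->].
have pdS : PD R n S by apply: (PD_block_dsum cP); split=> // i; case: (modS i).
have unitS := PD_unitmx pdS.
have vtxE k l : k \in V (c l) ->
    exists a b : 'I_#|V (c l)|, k = vtx a /\ l = vtx b.
  move=> kV; have [a ->] := vtx_surj kV.
  by have [|b lb] := @vtx_surj _ (V (c l)) l; [rewrite cP | exists a, b].
split=> // k l kl klE.
(* The conditions on the inverse and on [S] are treated alike: a pair in different blocks has entry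
   zero, and a pair in one block inherits the condition from that block. *)
all: have [kV|kV] := boolP (k \in V (c l)); last first.
- apply: (@invmx_disconnected _ _ _ (mem (V (c l)))) => //=.
    exact: S0V.
  by rewrite (negPf kV) cP eqxx.
- have [a [b [ka lb]]] := vtxE _ _ kV.
  have [_ SG _] := modS (c l).
  have := SG a b; rewrite invmx_block //; last exact: S0V.
  rewrite mxE -ka -lb; apply.
    by apply: contraNneq kl => ab; rewrite ka ab; apply/eqP/esym.
  by rewrite inE vtx_pair -ka -lb.
- by apply: (S0V (c l)); rewrite (negPf kV) cP eqxx.
- have [a [b [ka lb]]] := vtxE _ _ kV.
  have [_ _ SH] := modS (c l).
  have := SH a b; rewrite mxE -ka -lb; apply.
    by apply: contraNneq kl => ab; rewrite ka ab; apply/eqP/esym.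
  by rewrite inE vtx_pair -ka -lb.
Qed.

(** * Correlation models: the identity and a matrix supported on one common edge *)

Lemma PD1 (R : realType) (m : nat) : PD R m 1%:M.
Proof.
split; first exact: trmx1.
move=> x x0; rewrite mulmx1 mxE.
have /cV0Pn[k xk] := x0.
rewrite (bigD1 k) //= mxE ltr_pwDl //; first by rewrite -expr2 exprn_even_gt0.
by apply: sumr_ge0 => i _; rewrite mxE -expr2 sqr_ge0.
Qed.

Lemma corr_model1 (R : realType) (m : nat) (G H : sgraph 'I_m) :
  corr_model R G H 1%:M.
Proof.
split; last by move=> i; rewrite mxE eqxx.
split; first exact: PD1.
- by move=> i j /negPf ij _; rewrite invmx1 mxE ij.
- by move=> i j /negPf ij _; rewrite mxE ij.
Qed.

(** The value 1/2 is nonzero, and below 1 in absolute value, which keeps the block on a two-element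
    [e] positive definite. *)
Definition edge_mx (R : realType) (m : nat) (e : {set 'I_m}) : 'M[R]_m :=
  \matrix_(i, j) if i == j then 1 else if [set i; j]%SET == e then 2^-1 else 0.

(** Each vertex outside [e] is isolated in the support of the matrix, so the inverse too has no
    off-diagonal entry except at [e], an edge of both graphs. *)
Lemma edge_mx_corr (R : realType) (m : nat) (G H : sgraph 'I_m) e :
  e \in edges (graphI G H) -> corr_model R G H (edge_mx R e).
Proof.
move=> eE; have /cards2P[k [l [kl ekl]]] : #|e| == 2%N.
  by rewrite (edges_card2 eE).
move: eE; rewrite /= inE => /andP[eG eH].
have lk : l != k by rewrite eq_sym.
set S := edge_mx R e.
have offS i j : i \notin e -> i != j -> S i j = 0.
  move=> ie /negPf ij; rewrite mxE ij; case: eqP => // /setP/(_ i).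
  by rewrite !inE eqxx (negPf ie).
have S1 i : S i i = 1 by rewrite mxE eqxx.
have symS i j : S i j = S j i by rewrite !mxE eq_sym finset.setUC.
have pdS : PD R m S.
  split; first by apply/matrixP => i j; rewrite mxE symS.
  move=> x x0.
  (* Compare with the squared norm [N] of [x]: the form is [N] plus the product of the coordinates
     at [k] and [l], hence at least [N / 2]. *)
  have := proj2 (PD1 R m) x x0; rewrite mulmx1 mxE.
  under eq_bigr => i _ do rewrite mxE -expr2.
  rewrite quad_formE => N0.
  have rowE i : i \notin e ->
      \sum_j x i ord0 * S i j * x j ord0 = x i ord0 ^+ 2.
    move=> ie; rewrite (bigD1 i) //= S1 big1 ?addr0 ?mulr1 ?expr2 // => j ji.
    by rewrite offS ?mulr0 ?mul0r // eq_sym.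
  have rowkl i j : i != j -> [set i; j]%SET = e ->
      \sum_t x i ord0 * S i t * x t ord0
      = x i ord0 ^+ 2 + x i ord0 * 2^-1 * x j ord0.
    move=> ij ije; rewrite (bigD1 i) //= (bigD1 j) 1?eq_sym //= big1 ?addr0.
      by rewrite S1 mulr1 -expr2 mxE (negPf ij) ije eqxx.
    move=> t /andP[ti tj]; rewrite symS offS ?mulr0 ?mul0r //.
    by rewrite -ije !inE negb_or ti tj.
  move: N0; rewrite [X in _ -> _ < X](bigD1 k) //=.
  rewrite [X in _ -> _ < _ + X](bigD1 l) //=.
  rewrite (bigD1 k) //= (bigD1 l) //=.
  rewrite (rowkl k l) // (rowkl l k) 1?finset.setUC //.
  set s := \sum_(i < m | _) _ ^+ 2.
  have s_ge0 : 0 <= s by apply: sumr_ge0 => i _; exact: sqr_ge0.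
  rewrite (eq_bigr (fun i => x i ord0 ^+ 2)); last first.
    by move=> i /andP[ik il]; rewrite rowE // ekl !inE negb_or ik il.
  by rewrite -/s; nra.
split; last exact: S1.
split=> // i j ij.
- move=> ijG; have unitS := PD_unitmx pdS.
  (* The singleton of a vertex [t] outside [e] is a block of its own. *)
  have invS0 t : t \notin e -> (i == t) != (j == t) -> invmx S i j = 0.
    move=> te; apply: (@invmx_disconnected _ _ _ (fun u => u == t)) => // u v.
    have [->|ut] := eqVneq u t; have [->|vt] := eqVneq v t => // _.
      by rewrite offS // eq_sym.
    by rewrite symS offS // eq_sym.
  have [ie|ie] := boolP (i \in e); last first.
    by apply: (invS0 i) => //; rewrite eqxx (eq_sym j) (negPf ij).
  have [je|je] := boolP (j \in e); last first.
    by apply: (invS0 j) => //; rewrite eqxx (negPf ij).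
  have ije : [set i; j]%SET = e.
    apply/eqP; rewrite eqEcard cards2 ij (edges_card2 eG) leqnn andbT.
    by rewrite finset.subUset !finset.sub1set ie je.
  by rewrite ije eG in ijG.
- by rewrite mxE (negPf ij); case: eqP => // ->; rewrite eH.
Qed.

Theorem theorem1 (R : realType) (n : nat) (hn : (1 <= n)%N)
    (G H : sgraph 'I_n) (r : nat) (V : 'I_r -> {set 'I_n})
    (V_inj : injective V)
    (V_comp : [set V i | i : 'I_r]%SET = components (graphI G H)) :
  model R G H
    = block_dsum V (fun i => model R (induced G (V i)) (induced H (V i)))
  /\ (corr_model R G H = [set 1%:M]%classic
      <-> edges G :&: edges H = finset.set0).
Proof.
have VE i k l : k \in V i -> (l \in V i) = connect (adj (graphI G H)) k l.
  by apply: mem_components; rewrite -V_comp imset_f.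
have /fin_all_exists[c cV] : forall k, exists i, k \in V i.
  move=> k; have [B] := components_cover (graphI G H) k.
  by rewrite -V_comp => /imsetP[i _ ->]; exists i.
(* Components sharing a vertex coincide, and injectivity of [V] then identifies their indices. *)
have cP k i : (k \in V i) = (c k == i).
  apply/idP/eqP => [kV|<- //]; apply: V_inj; apply/setP => l.
  by rewrite (VE i _ _ kV) (VE _ _ _ (cV k)).
split.
  apply/seteqP; split=> S; last exact: (block_dsum_model cP).
  move=> modS; have S0 i k l : (k \in V i) != (l \in V i) -> S k l = 0.
    apply: (@model_disconnected _ _ _ _ _ (mem (V i)) modS) => u v uv /=.
    apply/idP/idP => [/VE->|/VE->]; first exact: connect1.
    by apply: connect1; rewrite /adj finset.setUC.
  split=> [i|k l kl]; first by apply: model_induced modS; exact: S0.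
  apply: (S0 (c k)); rewrite cV; move: (kl (c k)); rewrite cV /=.
  by move/negPf->.
split=> [corr1|E0].
  apply/eqP; apply: contraT => /set0Pn[e eE].
  have := edge_mx_corr R (G := G) (H := H) eE; rewrite corr1 /= => edge1.
  have /cards2P[k [l [kl ekl]]] : #|e| == 2%N by rewrite (graphI_card2 eE).
  move/matrixP/(_ k l): edge1; rewrite !mxE (negPf kl) -ekl eqxx mulr0n.
  by move/eqP; rewrite invr_eq0 pnatr_eq0.
apply/seteqP; split=> [S [modS S1]|_ ->]; last exact: corr_model1.
apply/matrixP => i j; rewrite mxE.
have [<-|ij] := eqVneq i j; first by rewrite S1.
(* Without common edges every predicate is constant on components; [pred1 i] separates [i] from
   [j]. *)
rewrite (@model_disconnected _ _ _ _ _ (pred1 i) modS) //=.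
  by move=> u v; rewrite /adj /= E0 inE.
by rewrite eqxx (eq_sym j) (negPf ij).
Qed.
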